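(* Let $G=(V\cup\{m\},E)$ and $G'=(V'\cup\{m'\},E')$ be comparability graphs with disjoint vertex sets such that $m$ is adjacent to all vertices of $V$ in $G$ or $m'$ is adjacent to all vertices of $V'$ in $G'$ (or both). Then $G\ast G'$ is a comparability graph. Moreover, if $\mathcal{R}^p(G)=k$ and $\mathcal{R}^p(G')=k'$, then $\mathcal{R}^p(G\ast G')=\max\{k,k'\}$.
   Context: All graphs are finite, simple and connected. A comparability graph is a graph admitting a transitive orientation ($\overrightarrow{ab},\overrightarrow{bc}$ imply $\overrightarrow{ac}$). A word over the vertex set represents a graph if distinct vertices are adjacent iff they alternate in the word (the subword formed by their occurrences is $abab\cdots$ or $baba\cdots$). Comparability graphs are exactly the graphs represented by a concatenation of permutations of their vertex set; $\mathcal{R}^p(G)$ is the least number of permutations whose concatenation represents $G$. Split recomposition: $G\ast G'$ has vertex set $V\cup V'$ and edges: those of $G[V]$, those of $G'[V']$, and all $\overline{ab}$ with $a\in N_G(m)$, $b\in N_{G'}(m')$. *)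

(* Defs.v *)
From HB Require Import structures.
From mathcomp Require Import all_boot.

Set Implicit Arguments.
Unset Strict Implicit.
Unset Printing Implicit Defensive.

Record graph (T : finType) := Graph {
  edge :> rel T;
  edge_sym : symmetric edge;
  edge_irr : irreflexive edge;
  edge_conn : forall x y, connect edge x y }.

Definition transitive_orientation (T : finType) (e o : rel T) : Prop :=
  [/\ forall x y, o x y -> e x y,
      forall x y, e x y -> o x y (+) o y x &
      transitive o].

Definition comparability (T : finType) (e : rel T) : Prop :=
  exists o : rel T, transitive_orientation e o.

Definition altword (T : eqType) (a b : T) (n : nat) : seq T :=
  mkseq (fun i => if odd i then b else a) n.

Definition alternate (T : eqType) (w : seq T) (a b : T) : bool :=
  let s := [seq z <- w | (z == a) || (z == b)] in
  (s == altword a b (size s)) || (s == altword b a (size s)).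

(* As usual for word-representability, every vertex must occur in the word; in
   particular the empty word represents no graph with a vertex. *)
Definition represents (T : finType) (w : seq T) (e : rel T) : Prop :=
  (forall x, x \in w) /\
  (forall a b, a != b -> e a b = alternate w a b).

Definition perm_representable (T : finType) (e : rel T) (k : nat) : Prop :=
  exists ps : seq (seq T),
    [/\ size ps = k,
        forall p, p \in ps -> perm_eq p (enum T) &
        represents (flatten ps) e].

(* [Rp e k] is the relation "R^p(e) = k"; the minimum is kept relational
   because it does not exist when [e] is not a comparability graph. *)
Definition Rp (T : finType) (e : rel T) (k : nat) : Prop :=
  perm_representable e k /\ (forall j, perm_representable e j -> k <= j).

(* A graph with vertex set V + {m} is a graph on [option V], the marked vertex
   m being [None]; the sum type makes the vertex sets V and V' disjoint. *)
Definition recomp_edge (V V' : finType)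
    (e : rel (option V)) (e' : rel (option V')) : rel (V + V') :=
  fun x y => match x, y with
  | inl a, inl b => e (Some a) (Some b)
  | inr a, inr b => e' (Some a) (Some b)
  | inl a, inr b => e None (Some a) && e' None (Some b)
  | inr b, inl a => e None (Some a) && e' None (Some b)
  end.

Section Recomposition.
Variables (V V' : finType) (G : graph (option V)) (G' : graph (option V')).
Let r := recomp_edge G G'.

Lemma recomp_sym : symmetric r.
Proof. by case=> a [] b //=; rewrite edge_sym. Qed.

Lemma recomp_irr : irreflexive r.
Proof. by case=> a /=; rewrite edge_irr. Qed.

Lemma homo_connect (S T : finType) (e : rel S) (f : rel T) (h : S -> T) :
  (forall x y, e x y -> f (h x) (h y)) ->
  forall x y, connect e x y -> connect f (h x) (h y).
Proof.
move=> hom x y /connectP[p]; elim: p x => [x _ -> //|z p IHp x /=].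
by case/andP=> /hom/connect1 xz /IHp zy /zy; apply: connect_trans.
Qed.

Lemma marked_neighbor (W : finType) (H : graph (option W)) :
  0 < #|W| -> exists w, H None (Some w).
Proof.
case/card_gt0P=> w _; case/connectP: (edge_conn H None (Some w)) => [[|z p]] //=.
by case: z => [z|]; rewrite ?edge_irr // => /andP[Hz _] _; exists z.
Qed.

(* Non-emptiness cannot be dropped: if V is empty, then the recomposition is G'
   with m' deleted, which may be disconnected. *)
Lemma recomp_conn : 0 < #|V| -> 0 < #|V'| -> forall x y, connect r x y.
Proof.
move=> /(marked_neighbor G)[a0 Ga0] /(marked_neighbor G')[b0 Gb0].
pose h x := if x is Some a then inl a else inr b0 : V + V'.
pose h' y := if y is Some b then inr b else inl a0 : V + V'.
have hom x y : G x y -> r (h x) (h y).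
  by case: x y => [a|] [b|] //=; rewrite ?edge_irr // 1?edge_sym => ->.
have hom' x y : G' x y -> r (h' x) (h' y).
  by case: x y => [a|] [b|] //=; rewrite ?edge_irr // 1?edge_sym ?Ga0 => ->.
have c x y : connect r (h x) (h y) by apply: homo_connect (edge_conn G x y).
have c' x y : connect r (h' x) (h' y) by apply: homo_connect (edge_conn G' x y).
case=> a [] b.
- exact: (c (Some a) (Some b)).
- exact: connect_trans (c (Some a) (Some a0)) (c' None (Some b)).
- exact: connect_trans (c' (Some a) None) (c (Some a0) (Some b)).
- exact: (c' (Some a) (Some b)).
Qed.

Definition recomp (V_gt0 : 0 < #|V|) (V'_gt0 : 0 < #|V'|) : graph (V + V')%type :=
  Graph recomp_sym recomp_irr (recomp_conn V_gt0 V'_gt0).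

End Recomposition.

(* Main.v *)
(* If m is universal in G, then G * G' is G' with the vertex m' replaced by the
   module G[V].  Two vertices alternate in a concatenation of permutations iff
   they come in the same order in all of them, so a permutational representation
   is a family of linear orders, encoded here by injective rankings in nat.
   Replacing m' by the order on V in each order on V' + {m'} gives the upper
   bound.  Conversely, G' is an induced subgraph of G * G', and so is G[V], from
   which G is recovered by putting m first in every order. *)
Require Import Defs.
From HB Require Import structures.
From mathcomp Require Import all_boot.

Set Implicit Arguments.
Unset Strict Implicit.
Unset Printing Implicit Defensive.

(** * Alternation in concatenated permutations *)

Lemma altwordSS (T : eqType) (a b : T) n :
  altword a b n.+2 = [:: a, b & altword a b n].
Proof.
rewrite /altword /mkseq /= (iotaDl 2 0) -map_comp; congr [:: _, _ & _].
by apply: eq_map => i /=; rewrite negbK.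
Qed.

(** All blocks have length two, so each one starts at an even position, where the alternating word
    has [a]. *)
Lemma altword_blocks (T : eqType) (a b : T) (cs : seq bool) : a != b ->
  let s := flatten [seq if c then [:: a; b] else [:: b; a] | c <- cs] in
  (s == altword a b (size s)) = all id cs.
Proof.
move=> neq_ab; elim: cs => // -[] cs IHcs; rewrite /= altwordSS !eqseq_cons.
  by rewrite !eqxx.
by rewrite eq_sym (negPf neq_ab).
Qed.

Lemma filter_pair_lt (T : eqType) (a b : T) (p : seq T) :
    uniq p -> b \in p -> index a p < index b p ->
  [seq z <- p | (z == a) || (z == b)] = [:: a; b].
Proof.
move=> uniq_p bp lt_ab.
have ap : a \in p by rewrite -index_mem (ltn_trans lt_ab) // index_mem.
have neq_ba : b != a by apply: contraTneq lt_ab => ->; rewrite ltnn.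
case/splitPr: ap uniq_p bp lt_ab => p1 p2.
rewrite cat_uniq /= negb_or => /and3P[_ /andP[ap1 _] /andP[ap2 uniq_p2]].
rewrite mem_cat inE (negPf neq_ba) !index_cat (negPf ap1) /= eqxx addn0.
case: ifPn => [bp1 _|bp1 /= bp2 _]; first by rewrite ltnNge index_size.
rewrite filter_cat /= eqxx /=.
rewrite (@eq_in_filter _ _ pred0 p1) ?filter_pred0; last first.
  by move=> z zp1; rewrite /= !(negPf (memPn _ _ zp1)).
congr cons; rewrite -(filter_pred1_uniq uniq_p2 bp2).
by apply: eq_in_filter => z zp2; rewrite /= (negPf (memPn ap2 _ zp2)).
Qed.

Lemma filter_flatten_pair (T : eqType) (a b : T) (ps : seq (seq T)) :
    a != b -> (forall p, p \in ps -> [/\ uniq p, a \in p & b \in p]) ->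
  [seq z <- flatten ps | (z == a) || (z == b)] =
    flatten [seq if c then [:: a; b] else [:: b; a]
            | c <- [seq index a p < index b p | p <- ps]].
Proof.
move=> neq_ab psP; rewrite filter_flatten -map_comp; congr flatten.
apply/eq_in_map => p /psP[uniq_p ap bp] /=; case: ltngtP => [||eq_ab].
- exact: filter_pair_lt.
- by rewrite (eq_filter (fun z => orbC _ _)); apply: filter_pair_lt.
- by rewrite (index_inj a ap bp eq_ab) eqxx in neq_ab.
Qed.

(** Each permutation leaves one block [ab] or [ba], so alternation starting with [a] means that
    every block is [ab], and symmetrically for [b]. *)
Lemma alternate_flatten (T : eqType) (a b : T) (ps : seq (seq T)) :
    a != b -> (forall p, p \in ps -> [/\ uniq p, a \in p & b \in p]) ->
  alternate (flatten ps) a b =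
    all (fun p => index a p < index b p) ps ||
    all (fun p => index b p < index a p) ps.
Proof.
move=> neq_ab psP; have neq_ba : b != a by rewrite eq_sym.
rewrite /alternate; congr orb.
  by rewrite filter_flatten_pair // altword_blocks // all_map.
rewrite (eq_filter (fun z => orbC _ _)) filter_flatten_pair //.
  by rewrite altword_blocks // all_map.
by move=> p /psP[].
Qed.

(** * Permutations as injective rankings *)

Definition same_order (T : Type) (k : nat) (f : nat -> T -> nat) (a b : T) :=
  all (fun i => f i a < f i b) (iota 0 k) ||
  all (fun i => f i b < f i a) (iota 0 k).

(** For positive [k] this is a realizer in the sense of order dimension: adjacency of distinct
    vertices is comparability in the intersection of the [k] linear orders. *)
Definition realizes (T : finType) (e : rel T) (k : nat) (f : nat -> T -> nat) :=
  (forall i, i < k -> injective (f i)) /\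
  (forall a b, a != b -> e a b = same_order k f a b).

Lemma sort_ranking (T : finType) (f : T -> nat) : injective f ->
  let p := sort (fun x y => f x <= f y) (enum T) in
  forall x y, (index x p < index y p) = (f x < f y).
Proof.
move=> inj_f p.
have memp x : x \in p by rewrite mem_sort mem_enum.
have tr : transitive (fun x y => f x <= f y) by move=> ? ? ?; apply: leq_trans.
have sorted_p : sorted (fun x y => f x <= f y) p.
  by apply: sort_sorted => x y; apply: leq_total.
have lt_le := sorted_ltn_index tr sorted_p.
move=> x y; case: (ltngtP (index x p)) => [lt_xy|lt_yx|eq_xy].
- rewrite ltn_neqAle lt_le // andbT (inj_eq inj_f).
  by apply/esym; apply: contraTneq lt_xy => ->; rewrite ltnn.
- by rewrite ltnNge lt_le.
- by rewrite (index_inj x (memp x) (memp y) eq_xy) ltnn.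
Qed.

(* The empty concatenation represents no graph with a vertex, whence [0 < k]. *)
Lemma perm_representableP (T : finType) (e : rel T) k : T ->
  perm_representable e k <-> 0 < k /\ exists f, realizes e k f.
Proof.
move=> t; split=> [[ps [<- psP [mem_w eE]]]|[k_gt0 [f [inj_f eE]]]].
  split; first by case: ps mem_w {psP eE} => // /(_ t).
  have memp p x : p \in ps -> x \in p.
    by move=> /psP/perm_mem->; rewrite mem_enum.
  (* The rank of a vertex is its position in the [i]-th permutation; conversely, sorting by rank
     will recover a permutation. *)
  exists (fun i x => index x (nth [::] ps i)); split=> [i lti x y|a b neq_ab].
    by apply: (index_inj t); apply/memp/mem_nth.
  rewrite eE // alternate_flatten // => [|p ps_p].
    by rewrite -{1 2}[ps](mkseq_nth [::]) !all_map.
  by rewrite !memp // (perm_uniq (psP _ ps_p)) enum_uniq.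
pose p i := sort (fun x y => f i x <= f i y) (enum T).
have mem_p i x : x \in p i by rewrite mem_sort mem_enum.
exists (mkseq p k); split=> [||].
- exact: size_mkseq.
- by move=> _ /mapP[i _ ->]; rewrite perm_sort.
split=> [x|a b neq_ab].
  apply/flattenP; exists (p 0) => //.
  by apply/mapP; exists 0; rewrite ?mem_iota.
rewrite eE // alternate_flatten // => [|_ /mapP[i _ ->]]; last first.
  by rewrite !mem_p sort_uniq enum_uniq.
rewrite /same_order !all_map; congr orb; apply: eq_in_all => i.
  by rewrite mem_iota => /inj_f inj_fi; rewrite /= sort_ranking.
by rewrite mem_iota => /inj_f inj_fi; rewrite /= sort_ranking.
Qed.

(** Repeating an order does not change which pairs come in the same order everywhere. Truncating the
    index at [k.-1] repeats the last one. *)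
Lemma realizes_leq (T : finType) (e : rel T) k l f : 0 < k <= l ->
  realizes e k f -> realizes e l (fun i => f (minn i k.-1)).
Proof.
case/andP=> k_gt0 le_kl [inj_f eE].
have lt_min i : minn i k.-1 < k by rewrite -[X in _ < X](prednK k_gt0) ltnS geq_minr.
split=> [i _|a b neq_ab]; first exact: inj_f.
have all_min (P : pred nat) :
    all P (iota 0 k) = all (fun i => P (minn i k.-1)) (iota 0 l).
  apply/allP/allP => Pi i; rewrite mem_iota => /= lti.
    by apply: Pi; rewrite mem_iota lt_min.
  have /minn_idPl <- : i <= k.-1 by rewrite -ltnS prednK.
  by apply: Pi; rewrite mem_iota (leq_trans lti).
by rewrite eE // /same_order !all_min.
Qed.

(** * Induced subgraphs and universal vertices *)

Lemma perm_representable_induced (S T : finType) (e : rel S) (e' : rel T)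
    (h : S -> T) k : S ->
    injective h -> (forall x y, x != y -> e x y = e' (h x) (h y)) ->
  perm_representable e' k -> perm_representable e k.
Proof.
move=> s inj_h eE /(perm_representableP _ _ (h s))[k_gt0 [f [inj_f e'E]]].
apply/(perm_representableP _ _ s); split=> //; exists (fun i x => f i (h x)); split.
  by move=> i lti x y /(inj_f i lti)/inj_h.
by move=> a b neq_ab; rewrite eE // e'E // (inj_eq inj_h).
Qed.

Lemma perm_representable_cone (V : finType) (e : rel (option V)) k : V ->
    symmetric e -> (forall v, e None (Some v)) ->
  perm_representable (fun a b => e (Some a) (Some b)) k ->
  perm_representable e k.
Proof.
move=> v0 e_sym e_univ /(perm_representableP _ _ v0)[k_gt0 [f [inj_f eE]]].
apply/(perm_representableP _ _ None); split=> //.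
(* The successor frees rank 0 for [None], which thus precedes all other vertices in every order. *)
exists (fun i x => if x is Some v then (f i v).+1 else 0); split.
  by move=> i lti [v|] [w|] //= [] /(inj_f i lti) ->.
case=> [v|] [w|] // neq_vw.
- by rewrite eE //.
- by rewrite e_sym e_univ /same_order orbC all_predT.
- by rewrite e_univ /same_order all_predT.
Qed.

(** * Lexicographic rankings and replacement of the marked vertex by a module *)

Lemma ltn_digits M a b x y : x < M -> y < M ->
  (a * M + x < b * M + y) = (a < b) || (a == b) && (x < y).
Proof.
move=> ltx lty; case: (ltngtP a b) => [lt_ab|lt_ba|->] /=.
- apply: (@leq_trans (a.+1 * M)); first by rewrite mulSnr ltn_add2l.
  by rewrite (leq_trans _ (leq_addr _ _)) // leq_mul2r lt_ab orbT.
- apply/negbTE; rewrite -leqNgt; apply: (@leq_trans (b.+1 * M)).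
    by rewrite mulSnr leq_add2l ltnW.
  by rewrite (leq_trans _ (leq_addr _ _)) // leq_mul2r lt_ba orbT.
- by rewrite ltn_add2l.
Qed.

Section UniversalMark.
Variables (V V' : finType) (e : rel (option V)) (e' : rel (option V')).
Hypotheses (e'_sym : symmetric e') (e_univ : forall v, e None (Some v)).

Lemma perm_representable_recomp k : V ->
    perm_representable e k -> perm_representable e' k ->
  perm_representable (recomp_edge e e') k.
Proof.
move=> v0 /(perm_representableP _ _ None)[k_gt0 [f [inj_f eE]]].
case/(perm_representableP _ _ None)=> _ [f' [inj_f' e'E]].
apply/(perm_representableP _ _ (inl v0 : V + V')); split=> //.
(* A strict bound on the ranks [f i x], so that they can serve as digits in base [M i]. *)
pose M i := (\max_x f i x).+1.
have ltM i x : f i x < M i by rewrite ltnS leq_bigmax.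
(* [h] collapses the module V onto the marked vertex of [e']; [g i] only breaks
   the ties that this creates. *)
pose h (x : V + V') := if x is inr b then Some b else None.
pose g i (x : V + V') := if x is inl a then f i (Some a) else 0.
have ltg i x : g i x < M i by case: x => [a|b]; rewrite /= ?ltM.
(* A two-digit number: the leading digit is the rank in the order on V' + {m'}, the last digit the
   rank inside the module. *)
pose F i x := f' i (h x) * M i + g i x.
have F_lt i x y : (F i x < F i y) =
    (f' i (h x) < f' i (h y)) || (f' i (h x) == f' i (h y)) && (g i x < g i y).
  exact: ltn_digits.
have F_module i a b : (F i (inl a) < F i (inl b)) = (f i (Some a) < f i (Some b)).
  by rewrite F_lt /= ltnn eqxx.
have F_h i x y : i < k -> h x != h y ->
    (F i x < F i y) = (f' i (h x) < f' i (h y)).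
  move=> lti neq_h; rewrite F_lt (inj_eq (inj_f' i lti)) (negPf neq_h).
  by rewrite orbF.
exists F; split=> [i lti x y eqF|x y neq_xy].
  have [eq_h|neq_h] := eqVneq (h x) (h y); last first.
    have := F_h _ _ _ lti neq_h; rewrite eqF ltnn.
    have := F_h i y x lti; rewrite eq_sym eqF ltnn => /(_ neq_h).
    case: ltngtP => // /(inj_f' i lti) eq_h; by rewrite eq_h eqxx in neq_h.
  move: eqF; rewrite /F eq_h => /addnI.
  case: x y eq_h => [a|b] [c|d] //=; last by case=> ->.
  by move=> _ /(inj_f i lti)[->].
have [eq_h|neq_h] := eqVneq (h x) (h y).
  case: x y neq_xy eq_h => [a|b] [c|d] //= neq_xy; last first.
    by case=> eq_bd; rewrite eq_bd eqxx in neq_xy.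
  move=> _; rewrite eE // /same_order.
  by congr orb; apply: eq_all => i; rewrite F_module.
(* Across different fibres of [h], universality of [m] makes adjacency depend only on the images
   under [h]. *)
have -> : recomp_edge e e' x y = e' (h x) (h y).
  by case: x y neq_h {neq_xy} => [a|b] [c|d] //=; rewrite e_univ //= ?andbT.
rewrite e'E // /same_order; congr orb; apply: eq_in_all => i;
  by rewrite mem_iota => lti; rewrite F_h // eq_sym.
Qed.

Lemma Rp_recomp k k' : 0 < #|V| -> symmetric e ->
  Rp e k -> Rp e' k' -> Rp (recomp_edge e e') (maxn k k').
Proof.
case/card_gt0P=> v0 _ e_sym [rep_e min_e] [rep_e' min_e']; split.
  have [k_gt0 [f fP]] := (perm_representableP _ _ None).1 rep_e.
  have [k'_gt0 [f' f'P]] := (perm_representableP _ _ None).1 rep_e'.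
  have max_gt0 : 0 < maxn k k' by rewrite leq_max k_gt0.
  (* The shorter family is padded with repeated orders, so that both have [maxn k k'] members. *)
  apply: perm_representable_recomp => //; apply/(perm_representableP _ _ None).
    split=> //; eexists; apply: (realizes_leq _ fP).
    by rewrite k_gt0 leq_maxl.
  split=> //; eexists; apply: (realizes_leq _ f'P).
  by rewrite k'_gt0 leq_maxr.
move=> j rep_j; rewrite geq_max; apply/andP; split.
  apply/min_e/perm_representable_cone => //.
  by apply: (perm_representable_induced (h := inl)) rep_j => // x y [].
apply: min_e'.
(* The vertex [v0] of V plays the role of [m']: as a neighbor of [m], it is joined in V' exactly to
   the neighbors of [m']. *)
pose h x : V + V' := if x is Some b then inr b else inl v0.
apply: (perm_representable_induced (h := h)) rep_j => [||].
- exact: None.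
- by case=> [b|] [c|] //= [->].
- by case=> [b|] [c|] //= _; rewrite e_univ //.
Qed.

(** Edges inside the module keep their orientation from [o]; all others are oriented by [o'] after
    collapsing V onto [m']. *)
Lemma comparability_recomp : irreflexive e' ->
  comparability e -> comparability e' -> comparability (recomp_edge e e').
Proof.
move=> e'_irr [o [o_e o_total o_tr]] [o' [o'_e o'_total o'_tr]].
have o'F x y : o' x y -> o' y x -> False.
  by move=> /o'_tr oxy /oxy/o'_e; rewrite e'_irr.
exists (fun x y => match x, y with
  | inl a, inl b => o (Some a) (Some b)
  | inl _, inr b => o' None (Some b)
  | inr b, inl _ => o' (Some b) None
  | inr a, inr b => o' (Some a) (Some b)
  end); split.
- case=> a [] b //=; rewrite ?e_univ.
  + exact: o_e.
  + exact: o'_e.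
  + by rewrite e'_sym; apply: o'_e.
  + exact: o'_e.
- case=> a [] b //=; rewrite ?e_univ.
  + exact: o_total.
  + exact: o'_total.
  + by rewrite e'_sym; apply: o'_total.
  + exact: o'_total.
- case=> b [] a [] c //=; try exact: o_tr; try exact: o'_tr.
  (* The remaining case is a directed path from V into V' and back, which would orient an edge at
     [m'] both ways. *)
  by move=> /o'F oF /oF.
Qed.

End UniversalMark.

(** * Exchange of the two factors, and the conclusion *)

Lemma comparability_induced (S T : finType) (e : rel S) (e' : rel T)
    (h : S -> T) : (forall x y, e x y = e' (h x) (h y)) ->
  comparability e' -> comparability e.
Proof.
move=> eE [o [o_e' o_total o_tr]]; exists (fun x y => o (h x) (h y)); split.
- by move=> x y; rewrite eE; apply: o_e'.
- by move=> x y; rewrite eE; apply: o_total.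
- by move=> y x z; apply: o_tr.
Qed.

Definition swap_sum (A B : Type) (x : A + B) : B + A :=
  match x with inl a => inr a | inr b => inl b end.

Lemma swap_sumK (A B : Type) : cancel (@swap_sum A B) (@swap_sum B A).
Proof. by case. Qed.

(** This isomorphism reduces the case of a universal [m'] to that of a universal [m]. *)
Lemma recomp_edge_swap (V V' : finType) (e : rel (option V))
    (e' : rel (option V')) x y :
  recomp_edge e e' x y = recomp_edge e' e (swap_sum x) (swap_sum y).
Proof. by case: x y => a [] b //=; rewrite andbC. Qed.

Lemma perm_representable_recompC (V V' : finType) (e : rel (option V))
    (e' : rel (option V')) k : 0 < #|V| ->
  perm_representable (recomp_edge e' e) k -> perm_representable (recomp_edge e e') k.
Proof.
case/card_gt0P=> v0 _; apply: (perm_representable_induced (h := @swap_sum V V')).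
- exact: inl v0.
- exact: can_inj (@swap_sumK V V').
- by move=> x y _; apply: recomp_edge_swap.
Qed.

Theorem theorem7 (V V' : finType) (V_gt0 : 0 < #|V|) (V'_gt0 : 0 < #|V'|)
    (G : graph (option V)) (G' : graph (option V'))
    (G_comp : comparability G) (G'_comp : comparability G')
    (m_universal : (forall v : V, G None (Some v)) \/
                   (forall v' : V', G' None (Some v'))) :
  comparability (recomp G G' V_gt0 V'_gt0) /\
  (forall k k' : nat, Rp G k -> Rp G' k' ->
     Rp (recomp G G' V_gt0 V'_gt0) (maxn k k')).
Proof.
have [symG symG'] := (@edge_sym _ G, @edge_sym _ G').
case: m_universal => [G_univ|G'_univ].
  split=> [|k k' RG RG']; first exact: comparability_recomp (@edge_irr _ G') _ _.
  exact: Rp_recomp.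
split=> [|k k' RG RG'].
  apply: (comparability_induced (recomp_edge_swap G G')).
  exact: comparability_recomp (@edge_irr _ G) _ _.
(* With the factors exchanged, [m'] is the universal mark; the representation and the lower bound
   are then carried back through the swap. *)
have [rep min_rep] : Rp (recomp_edge G' G) (maxn k' k) by apply: Rp_recomp.
rewrite maxnC; split=> [|j rep_j]; first exact: perm_representable_recompC.
by apply/min_rep/perm_representable_recompC.
Qed.
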